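(* Let $\alpha\in(1,2)$, let $d:[x_L,x_R]\to\mathbb{R}$ satisfy $0<d_-\le d(x)\le d_+<\infty$, and let $\varphi:[x_L,x_R]\to\mathbb{R}$ and $f:[x_L,x_R]\times[0,T]\to\mathbb{R}$ be given functions. For all positive integers $M,N$, the finite difference scheme $$\frac1{\tau}\left(u^{n}-u^{n-1}\right)=\frac{1}{2h^\alpha}DG_\alpha\left(u^{n-1}+u^{n}\right)+f^{n-\frac12},\qquad n=1,\dots,N,\qquad u^0=\varphi:=(\varphi(x_1),\dots,\varphi(x_M))^T,$$ is unconditionally stable, and its solution satisfies $$\left\|u^{n}\right\|_{D^{-1}}^2\leq \exp(2T)\left\|\varphi\right\|_{D^{-1}}^2+[\exp(2T)-1]\max_{1\leq k\leq n}\left\|f^{k-\frac12}\right\|_{D^{-1}}^2,\qquad n=1,2,\ldots,N.$$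
   Context: Let $x_L<x_R$, $T>0$, $h=(x_R-x_L)/(M+1)$, $\tau=T/N$, $x_i=x_L+ih$ $(0\le i\le M+1)$, $t_n=n\tau$ $(0\le n\le N)$, $t_{n-\frac12}=(t_{n-1}+t_n)/2$. Define $g_0^{(\alpha)}=1$, $g_k^{(\alpha)}=\left(1-\frac{\alpha+1}{k}\right)g_{k-1}^{(\alpha)}$ for $k\ge1$, and $w_0^{(\alpha)}=\frac{\alpha}{2}g_0^{(\alpha)}$, $w_k^{(\alpha)}=\frac{\alpha}{2}g_k^{(\alpha)}+\frac{2-\alpha}{2}g_{k-1}^{(\alpha)}$ for $k\ge1$. $G_\alpha\in\mathbb{R}^{M\times M}$ is the Toeplitz matrix whose $(i,j)$ entry is $w_{i-j+1}^{(\alpha)}$ if $i-j+1\ge0$ and $0$ otherwise. $D=\mathrm{diag}(d(x_1),\dots,d(x_M))$, $f^{n-\frac12}=(f(x_1,t_{n-\frac12}),\dots,f(x_M,t_{n-\frac12}))^T$. The vector $u^n=(u^n_1,\dots,u^n_M)^T$ is the numerical solution at time $t_n$. The norm $\|\cdot\|_{D^{-1}}$ on $\mathbb{R}^M$ is induced by the inner product $\langle v_1,v_2\rangle_{D^{-1}}:=h\,v_1^TD^{-1}v_2$. ''Unconditionally stable'' means that the displayed estimate holds with no restriction relating $\tau$ and $h$. *)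

(* Defs.v *)
From mathcomp Require Import all_boot all_order all_algebra.
From mathcomp Require Import reals sequences exp.

Set Implicit Arguments.
Unset Strict Implicit.
Unset Printing Implicit Defensive.

Import Order.TTheory GRing.Theory Num.Theory.
Local Open Scope ring_scope.

Definition stepx (R : realType) (xL xR : R) (M : nat) : R :=
  (xR - xL) / M.+1%:R.

Definition stept (R : realType) (T : R) (N : nat) : R := T / N%:R.

Definition gridx (R : realType) (xL xR : R) (M i : nat) : R :=
  xL + i%:R * stepx xL xR M.

Definition gridt (R : realType) (T : R) (N n : nat) : R := n%:R * stept T N.

(* t_{n-1/2}; only meaningful for 1 <= n. *)
Definition midt (R : realType) (T : R) (N n : nat) : R :=
  (gridt T N n.-1 + gridt T N n) / 2.

Fixpoint gcoef (R : realType) (alpha : R) (k : nat) : R :=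
  if k is k'.+1 then (1 - (alpha + 1) / k%:R) * gcoef alpha k' else 1.

Definition wcoef (R : realType) (alpha : R) (k : nat) : R :=
  if k is k'.+1
  then alpha / 2 * gcoef alpha k + (2 - alpha) / 2 * gcoef alpha k'
  else alpha / 2 * gcoef alpha 0.

(* The ordinal i : 'I_M stands for the 1-based index i.+1; the difference of
   two indices is unaffected by this shift. *)
Definition Gmx (R : realType) (alpha : R) (M : nat) : 'M[R]_M :=
  \matrix_(i < M, j < M)
    if (j <= i.+1)%N then wcoef alpha (i.+1 - j)%N else 0.

Definition gridcol (R : realType) (xL xR : R) (M : nat) (v : R -> R) :
    'cV[R]_M :=
  \col_(i < M) v (gridx xL xR M i.+1).

Definition Dmx (R : realType) (xL xR : R) (M : nat) (d : R -> R) : 'M[R]_M :=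
  diag_mx (gridcol xL xR M d)^T.

Definition fmid (R : realType) (xL xR T : R) (M N : nat) (f : R -> R -> R)
    (n : nat) : 'cV[R]_M :=
  gridcol xL xR M (fun x => f x (midt T N n)).

Definition Dinner (R : realType) (xL xR : R) (M : nat) (d : R -> R)
    (v1 v2 : 'cV[R]_M) : R :=
  stepx xL xR M * (v1^T *m invmx (Dmx xL xR M d) *m v2) 0 0.

Definition Dnorm (R : realType) (xL xR : R) (M : nat) (d : R -> R)
    (v : 'cV[R]_M) : R :=
  Num.sqrt (Dinner xL xR d v v).

(* Only the values u 0, ..., u N are constrained. *)
Definition scheme_solution (R : realType) (alpha xL xR T : R) (M N : nat)
    (d phi : R -> R) (f : R -> R -> R) (u : nat -> 'cV[R]_M) : Prop :=
  u 0%N = gridcol xL xR M phi /\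
  forall n : nat, (1 <= n <= N)%N ->
    (stept T N)^-1 *: (u n - u n.-1) =
    (2 * stepx xL xR M `^ alpha)^-1 *:
      (Dmx xL xR M d *m Gmx alpha M *m (u n.-1 + u n))
    + fmid xL xR T M N f n.

(* Main.v *)
Require Import Defs.
From mathcomp Require Import all_boot all_order all_algebra.
From mathcomp Require Import reals sequences exp.
From mathcomp Require Import ring lra zify.
Import Order.TTheory GRing.Theory Num.Theory.
Local Open Scope ring_scope.

(** The proof is an energy estimate that never needs a small time step. Pair
    the scheme with u^n + u^{n-1} in the D^{-1} inner product: D cancels, the
    time difference becomes the difference of two squared norms, and the spatial
    term becomes a positive multiple of the quadratic form of G_alpha
    ([energy_identity]). That form is nonpositive ([Gmx_form_le0]), so
    Cauchy-Schwarz leaves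
      ||u^n||^2 - ||u^{n-1}||^2 <= tau ||f|| (||u^n|| + ||u^{n-1}||).
    Dividing by the sum of the norms gives a bound linear in the norms,
    ||u^n|| <= ||u^{n-1}|| + tau ||f|| ([scheme_step]), hence
    ||u^n|| <= ||phi|| + T max ||f||: the growth is linear in time. The exponential constants come from Young's inequality with
    parameter exp(2T) - 1, which applies because T exp(T) <= exp(2T) - 1
    ([sqr_growth_le]).

    The nonpositivity of the form rests on the weights: the symmetric part of
    G_alpha has nonnegative off-diagonal entries, because w_0 + w_2 >= 0 and
    w_k >= 0 for k >= 3, while its row sums are nonpositive, because
    w_1 <= 0 and w_0 + ... + w_n <= 0 for n >= 2. The partial sums are explicit: summing the
    g_k of order alpha gives the g_n of order alpha - 1, a discrete form of
    integrating a fractional derivative once. *)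

(** * Signs and partial sums of the weights *)

(** Comparison of the binomial coefficients of (1 - z)^alpha and
    (1 - z)^(alpha - 1). It yields both the telescoping of the partial sums and
    the positivity of g_k for k >= 2, from a single sign computation. *)
Lemma gcoefS_shift (R : realType) (alpha : R) (n : nat) :
  gcoef alpha n.+1 = - alpha / n.+1%:R * gcoef (alpha - 1) n.
Proof.
elim: n => [|n IHn]; first by rewrite /= invr1; ring.
have -> : gcoef alpha n.+2 = (1 - (alpha + 1) / n.+2%:R) * gcoef alpha n.+1 by [].
rewrite IHn /=; field.
have n_ge0 : 0 <= n%:R :> R by [].
by apply/andP; split; apply/lt0r_neq0; lra.
Qed.

(** Dividing the generating function (1 - z)^alpha by 1 - z takes partial sums of
    its coefficients and lowers the exponent by one. *)
Lemma sum_gcoef (R : realType) (alpha : R) (n : nat) :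
  \sum_(0 <= k < n.+1) gcoef alpha k = gcoef (alpha - 1) n.
Proof.
elim: n => [|n IHn]; first by rewrite big_nat1.
rewrite big_nat_recr // IHn gcoefS_shift /=; field.
have n_ge0 : 0 <= n%:R :> R by [].
by apply/lt0r_neq0; lra.
Qed.

(** In the product of the factors 1 - alpha / k, only the first is negative. *)
Lemma gcoef_shift_le0 (R : realType) (alpha : R) (n : nat) :
  1 < alpha < 2 -> gcoef (alpha - 1) n.+1 <= 0.
Proof.
move=> ha; elim: n => [|n IHn]; first by rewrite /= divr1; lra.
have -> : gcoef (alpha - 1) n.+2
          = (1 - (alpha - 1 + 1) / n.+2%:R) * gcoef (alpha - 1) n.+1 by [].
rewrite mulr_ge0_le0 // subr_ge0 ler_pdivrMr ?ltr0n // mul1r.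
apply: (@le_trans _ _ 2); first by lra.
by rewrite ler_nat.
Qed.

Lemma gcoef_ge0 (R : realType) (alpha : R) (n : nat) :
  1 < alpha < 2 -> 0 <= gcoef alpha n.+2.
Proof.
move=> ha; rewrite gcoefS_shift mulr_le0 ?gcoef_shift_le0 //.
rewrite mulNr oppr_le0 divr_ge0 //; lra.
Qed.

Lemma wcoef1_le0 (R : realType) (alpha : R) :
  1 < alpha < 2 -> wcoef alpha 1 <= 0.
Proof. by move=> ha; rewrite /= divr1; nra. Qed.

(** Taken alone w_2 is negative for alpha close to 1. The weights w_0 and w_2 are
    the two sides of the same symmetrized off-diagonal, so only their sum
    matters. *)
Lemma wcoef02_ge0 (R : realType) (alpha : R) :
  1 < alpha < 2 -> 0 <= wcoef alpha 0 + wcoef alpha 2.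
Proof.
move=> ha /=; rewrite divr1.
have -> : alpha / 2 * 1 + (alpha / 2 * ((1 - (alpha + 1) / 2) *
  ((1 - (alpha + 1)) * 1)) + (2 - alpha) / 2 * ((1 - (alpha + 1)) * 1))
  = alpha * (alpha + 2) * (alpha - 1) / 4 by field.
by rewrite divr_ge0 // mulr_ge0 ?mulr_ge0 //; lra.
Qed.

Lemma wcoef_ge0 (R : realType) (alpha : R) (n : nat) :
  1 < alpha < 2 -> 0 <= wcoef alpha n.+3.
Proof.
move=> ha.
have -> : wcoef alpha n.+3 =
  alpha / 2 * gcoef alpha n.+3 + (2 - alpha) / 2 * gcoef alpha n.+2 by [].
by rewrite addr_ge0 // mulr_ge0 ?gcoef_ge0 //; lra.
Qed.

(** Both terms on the right are nonpositive once n >= 1; for n = 0 the sum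
    w_0 + w_1 = (2 - alpha^2) / 2 is positive when alpha is below the square root
    of 2. *)
Lemma sum_wcoef (R : realType) (alpha : R) (n : nat) :
  \sum_(0 <= k < n.+2) wcoef alpha k =
  alpha / 2 * gcoef (alpha - 1) n.+1 + (2 - alpha) / 2 * gcoef (alpha - 1) n.
Proof.
rewrite big_nat_recl // -!sum_gcoef.
under eq_bigr => k _ do
  rewrite [wcoef alpha k.+1](_ : _ =
    alpha / 2 * gcoef alpha k.+1 + (2 - alpha) / 2 * gcoef alpha k) //.
rewrite big_split -!mulr_sumr addrA; congr (_ + _).
by rewrite (@big_nat_recl _ _ _ n.+1 0) // mulrDr.
Qed.

(** * Negativity of the quadratic form of G_alpha *)

(** With B the symmetrized matrix, twice the form equals
    sum_i v_i^2 (sum_j B_ij) - 1/2 sum_ij B_ij (v_i - v_j)^2: a nonpositive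
    diagonal part minus the energy of a graph Laplacian whose edge weights B_ij
    are nonnegative. *)
Lemma quad_form_le0 (R : realType) (M : nat) (A : 'M[R]_M) (v : 'cV[R]_M) :
  (forall i j, i != j -> 0 <= A i j + A j i) ->
  (forall i, \sum_j (A i j + A j i) <= 0) ->
  \sum_i v i 0 * (A *m v) i 0 <= 0.
Proof.
move=> offdiag rowsum.
pose B i j := A i j + A j i.
have Avv : \sum_i v i 0 * (A *m v) i 0 = \sum_i \sum_j v i 0 * A i j * v j 0.
  apply: eq_bigr => i _; rewrite mxE mulr_sumr.
  by apply: eq_bigr => j _; rewrite mulrA.
have AvvT : \sum_i v i 0 * (A *m v) i 0 = \sum_i \sum_j v i 0 * A j i * v j 0.
  rewrite Avv exchange_big; apply: eq_bigr => i _; apply: eq_bigr => j _.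
  by ring.
have rowE : \sum_i (v i 0) ^+ 2 * \sum_j B i j = \sum_i \sum_j B i j * v i 0 ^+ 2.
  by apply: eq_bigr => i _; rewrite mulr_sumr; apply: eq_bigr => j _; ring.
have colE : \sum_i (v i 0) ^+ 2 * \sum_j B i j = \sum_i \sum_j B i j * v j 0 ^+ 2.
  rewrite rowE exchange_big; apply: eq_bigr => i _; apply: eq_bigr => j _.
  by rewrite /B; ring.
have diag_le0 : \sum_i (v i 0) ^+ 2 * \sum_j B i j <= 0.
  apply: sumr_le0 => i _; apply: mulr_ge0_le0; first exact: sqr_ge0.
  exact: rowsum.
have sq_ge0 : 0 <= \sum_i \sum_j B i j * (v i 0 - v j 0) ^+ 2.
  apply: sumr_ge0 => i _; apply: sumr_ge0 => j _.
  have [->|neq_ij] := eqVneq i j; first by rewrite subrr expr0n mulr0.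
  by rewrite mulr_ge0 ?sqr_ge0 ?offdiag.
suff : \sum_i \sum_j B i j * (v i 0 - v j 0) ^+ 2 =
  \sum_i \sum_j B i j * v i 0 ^+ 2 + \sum_i \sum_j B i j * v j 0 ^+ 2
  - 2 * (\sum_i \sum_j v i 0 * A i j * v j 0
         + \sum_i \sum_j v i 0 * A j i * v j 0).
  rewrite -rowE -colE -Avv -AvvT.
  move: diag_le0 sq_ge0; move: (\sum_i _) (\sum_i _) (\sum_i _) => X Y q.
  by lra.
rewrite -!big_split mulr_sumr -sumrB; apply: eq_bigr => i _.
rewrite -!big_split mulr_sumr -sumrB; apply: eq_bigr => j _ /=.
by rewrite /B; ring.
Qed.

Lemma Gmx_offdiag_ge0 (R : realType) (alpha : R) (M : nat) (i j : 'I_M) :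
  1 < alpha < 2 -> i != j -> 0 <= Gmx alpha M i j + Gmx alpha M j i.
Proof.
move=> ha; wlog lt_ij : i j / (i < j)%N => [wlogH neq_ij|_].
  have [lt_ij|lt_ji|eq_ij] := ltngtP i j.
  - exact: wlogH.
  - by rewrite addrC wlogH // eq_sym.
  - by rewrite (val_inj eq_ij) eqxx in neq_ij.
rewrite !mxE (leq_trans (ltnW lt_ij) (leqnSn j)).
have [le_jSi|lt_Sij] := leqP j i.+1.
  have -> : nat_of_ord j = i.+1 by apply/eqP; rewrite eqn_leq le_jSi.
  by rewrite subnn subSn // subSnn wcoef02_ge0.
rewrite add0r; have [k ->] : exists k, (j.+1 - i = k.+3)%N.
  by exists (j.+1 - i).-2.-1; lia.
exact: wcoef_ge0.
Qed.

(** The row of index i of the symmetrized matrix is 2 w_1 on the diagonal, with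
    the sequence [c] = (w_0 + w_2, w_3, w_4, ...) running away from it in both
    directions until the matrix border. Every partial sum of [c] is at most
    - w_1, so each of the two sides is absorbed by one copy of w_1. *)
Lemma Gmx_rowsum_le0 (R : realType) (alpha : R) (M : nat) (i : 'I_M) :
  1 < alpha < 2 -> \sum_j (Gmx alpha M i j + Gmx alpha M j i) <= 0.
Proof.
move=> ha.
pose c k := wcoef alpha k.+2 + (if k is 0 then wcoef alpha 0 else 0).
have sum_c n : \sum_(0 <= k < n) c k <= - wcoef alpha 1.
  case: n => [|n]; first by rewrite big_geq // oppr_ge0 wcoef1_le0.
  have -> : \sum_(0 <= k < n.+1) c k
            = \sum_(0 <= k < n.+3) wcoef alpha k - wcoef alpha 1.
    rewrite [in RHS]big_nat_recl // [in RHS]big_nat_recl //.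
    rewrite [in RHS]addrCA [RHS]addrC addKr [RHS]addrC big_split.
    congr (_ + _); rewrite big_nat_recl // big1 //; exact: addr0.
  rewrite gerDr sum_wcoef.
  by rewrite -[leRHS]addr0 lerD // mulr_ge0_le0 ?gcoef_shift_le0 //; lra.
(* The symmetrized entry as a function of natural-number indices, so that the
   row can be cut at the diagonal and reindexed by the distance to it. *)
pose s (i j : nat) := (if (j <= i.+1)%N then wcoef alpha (i.+1 - j) else 0)
                    + (if (i <= j.+1)%N then wcoef alpha (j.+1 - i) else 0).
have sC k l : s k l = s l k by rewrite /s addrC.
have s_c k l : s (k + l.+1)%N k = c l.
  rewrite /s leqW ?leq_addr //.
  have -> : ((k + l.+1).+1 - k = l.+2)%N by lia.
  congr (_ + _); case: l => [|l].
    by rewrite addn1 leqnn subnn.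
  by case: leqP => //; lia.
have s_diag k : s k k = wcoef alpha 1 + wcoef alpha 1.
  by rewrite /s leqnSn subSnn.
have -> : \sum_j (Gmx alpha M i j + Gmx alpha M j i) = \sum_(0 <= j < M) s i j.
  by rewrite big_mkord; apply: eq_bigr => j _; rewrite !mxE.
rewrite (@big_cat_nat _ _ _ i) ?(ltnW (ltn_ord i)) //=.
rewrite (@big_ltn _ _ _ i) ?ltn_ord // s_diag.
have -> : \sum_(0 <= j < i) s i j = \sum_(0 <= k < i) c k.
  rewrite big_nat_rev /= add0n; apply: eq_big_nat => k /= lt_ki.
  by rewrite -(s_c (i - k.+1)%N); congr s; lia.
have -> : \sum_(i.+1 <= j < M) s i j = \sum_(0 <= k < M - i.+1) c k.
  rewrite -[i.+1]add0n big_addn add0n; apply: eq_big_nat => k _.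
  by rewrite sC -(s_c i); congr s; lia.
by have := sum_c i; have := sum_c (M - i.+1)%N; lra.
Qed.

Lemma Gmx_form_le0 (R : realType) (alpha : R) (M : nat) (v : 'cV[R]_M) :
  1 < alpha < 2 -> \sum_i v i 0 * (Gmx alpha M *m v) i 0 <= 0.
Proof.
move=> ha; apply: quad_form_le0 => [i j|i]; first exact: Gmx_offdiag_ge0.
exact: Gmx_rowsum_le0.
Qed.

(** * Energy estimate in a weighted inner product *)

Definition wdot (R : realType) (M : nat) (p : 'I_M -> R) (x y : 'cV[R]_M) : R :=
  \sum_i p i * (x i 0 * y i 0).
Arguments wdot {R M} p x y.

Lemma wdot_ge0 (R : realType) (M : nat) (p : 'I_M -> R) (x : 'cV[R]_M) :
  (forall i, 0 <= p i) -> 0 <= wdot p x x.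
Proof.
by move=> p0; apply: sumr_ge0 => i _; rewrite mulr_ge0 // -expr2 sqr_ge0.
Qed.

Lemma wdotDr (R : realType) (M : nat) (p : 'I_M -> R) (x y z : 'cV[R]_M) :
  wdot p x (y + z) = wdot p x y + wdot p x z.
Proof. by rewrite -big_split; apply: eq_bigr => i _; rewrite mxE !mulrDr. Qed.

(** Lagrange's identity: the defect in the squared inequality is half a double sum
    of weighted squares, so no case distinction on vanishing vectors arises. *)
Lemma wdot_CauchySchwarz (R : realType) (M : nat) (p : 'I_M -> R)
    (x y : 'cV[R]_M) :
  (forall i, 0 <= p i) ->
  wdot p x y <= Num.sqrt (wdot p x x) * Num.sqrt (wdot p y y).
Proof.
move=> p0; have [xx0 yy0] := (wdot_ge0 _ _ p x p0, wdot_ge0 _ _ p y p0).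
rewrite -sqrtrM //; apply: (le_trans (ler_norm _)).
rewrite -sqrtr_sqr ler_sqrt ?mulr_ge0 //.
have : 0 <= \sum_i \sum_j p i * p j * (x i 0 * y j 0 - x j 0 * y i 0) ^+ 2.
  apply: sumr_ge0 => i _; apply: sumr_ge0 => j _.
  by rewrite mulr_ge0 ?sqr_ge0 ?mulr_ge0.
suff -> : \sum_i \sum_j p i * p j * (x i 0 * y j 0 - x j 0 * y i 0) ^+ 2
  = wdot p x x * wdot p y y + wdot p y y * wdot p x x
    - 2 * (wdot p x y * wdot p x y) by rewrite expr2; lra.
rewrite /wdot !big_distrlr -big_split mulr_sumr -sumrB; apply: eq_bigr => i _.
rewrite -big_split mulr_sumr -sumrB; apply: eq_bigr => j _ /=.
by ring.
Qed.

(** The weight p is inversely proportional to D, which turns D A into a multiple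
    of A when paired with b + a; (a - b, b + a) telescopes by symmetry. *)
Lemma energy_identity (R : realType) (M : nat) (p : 'I_M -> R) (D : 'rV[R]_M)
    (A : 'M[R]_M) (a b g : 'cV[R]_M) (tau c k : R) :
  tau != 0 -> (forall i, p i * D 0 i = k) ->
  tau^-1 *: (a - b) = c *: (diag_mx D *m A *m (b + a)) + g ->
  wdot p a a - wdot p b b
  = tau * (c * k * \sum_i (b + a) i 0 * (A *m (b + a)) i 0 + wdot p g (b + a)).
Proof.
move=> tau0 pD eq_ab.
rewrite /wdot mulr_sumr -sumrB -big_split mulr_sumr; apply: eq_bigr => i _ /=.
(* The identity holds component by component: it is the i-th equation of the
   scheme multiplied by p_i (b_i + a_i). *)
have := congr1 (fun v : 'cV_M => tau * v i 0) eq_ab.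
rewrite -mulmxA mul_diag_mx !mxE /= [X in X = _ -> _]mulrA mulfV // mul1r => eq_i.
rewrite -(pD i); set s := \sum_j _ in eq_i *.
transitivity (p i * ((a i 0 - b i 0) * (b i 0 + a i 0))); first by ring.
by rewrite eq_i; ring.
Qed.

Lemma Dinner_wdot (R : realType) (xL xR : R) (M : nat) (d : R -> R)
    (v1 v2 : 'cV[R]_M) :
  (forall i : 'I_M, d (gridx xL xR M i.+1) != 0) ->
  Dinner xL xR d v1 v2
  = wdot (fun i => stepx xL xR M / d (gridx xL xR M i.+1)) v1 v2.
Proof.
move=> d0; pose e := \row_(i < M) (d (gridx xL xR M i.+1))^-1.
have De : Dmx xL xR M d *m diag_mx e = 1%:M.
  rewrite /Dmx mulmx_diag -[RHS]diag_const_mx; congr diag_mx.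
  by apply/rowP => i; rewrite !mxE mulfV.
have [Dunit _] := mulmx1_unit De.
have -> : Dinner xL xR d v1 v2
    = stepx xL xR M * (v1^T *m diag_mx e *m v2) 0 0.
  by rewrite /Dinner -[diag_mx e](mulKmx Dunit) De mulmx1.
rewrite mul_mx_diag mxE mulr_sumr; apply: eq_bigr => i _.
by rewrite !mxE; ring.
Qed.

(** Division of the hypothesis by b + a, in a form that also covers b + a = 0. *)
Lemma sqr_step_le (R : realDomainType) (a b r : R) :
  0 <= a -> 0 <= b -> 0 <= r -> a ^+ 2 - b ^+ 2 <= r * (b + a) -> a <= b + r.
Proof.
move=> a0 b0 r0 le_ab; rewrite leNgt; apply/negP => lt_a.
by nra.
Qed.

(** Young's inequality 2 a (T m) <= s a^2 + (T m)^2 / s with s = exp(2T) - 1 leaves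
    the coefficient T^2 exp(2T) / s in front of m^2. It is at most s because
    T exp(T) <= s, a consequence of exp(T) >= 1 + T. *)
Lemma sqr_growth_le (R : realType) (T a m : R) :
  0 < T -> (a + T * m) ^+ 2
           <= expR (2 * T) * a ^+ 2 + (expR (2 * T) - 1) * m ^+ 2.
Proof.
move=> T0; have := expR_ge1Dx T; rewrite mulr_natl mulr2n expRD.
set e := expR T => le_e.
pose s := e * e - 1.
have Te_s : T * e <= s by rewrite /s; nra.
have s0 : 0 < s by rewrite /s; nra.
have T_s : (1 + s) * T ^+ 2 <= s ^+ 2.
  have -> : (1 + s) * T ^+ 2 = (T * e) ^+ 2 by rewrite /s; ring.
  by rewrite ler_sqr ?nnegrE ?mulr_ge0 //; [exact: ltW| nra |exact: ltW].
have -> : e * e = 1 + s by rewrite /s; ring.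
(* Multiplication by s clears the denominator and exposes the square behind
   Young's inequality. *)
rewrite -subr_ge0 -(pmulr_rge0 _ s0).
have -> : s * ((1 + s) * a ^+ 2 + (1 + s - 1) * m ^+ 2 - (a + T * m) ^+ 2)
   = (s * a - T * m) ^+ 2 + (s ^+ 2 - (1 + s) * T ^+ 2) * m ^+ 2 by ring.
by rewrite addr_ge0 ?sqr_ge0 // mulr_ge0 ?sqr_ge0 // subr_ge0.
Qed.

Lemma gridx_mem (R : realType) (xL xR : R) (M i : nat) :
  xL < xR -> (i <= M.+1)%N -> xL <= gridx xL xR M i <= xR.
Proof.
move=> hx le_iM; rewrite /gridx /stepx.
have hM : 0 < M.+1%:R :> R by rewrite ltr0n.
have x_gt0 : 0 < xR - xL by rewrite subr_gt0.
apply/andP; split.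
  by rewrite lerDl mulr_ge0 // divr_ge0 ?ltW.
rewrite -lerBrDl mulrA ler_pdivrMr // mulrC ler_pM2l //.
by rewrite ler_nat.
Qed.

(** The previous norm enters with factor exactly 1 and the forcing with factor
    tau, so n steps accumulate at most n tau <= T times the forcing, whatever the
    relation between tau and h. *)
Lemma scheme_step (R : realType) (xL xR T alpha : R) (d phi : R -> R)
    (f : R -> R -> R) (M N : nat) (u : nat -> 'cV[R]_M) (n : nat) :
  xL < xR -> 0 < T -> 1 < alpha < 2 ->
  (forall x : R, xL <= x <= xR -> 0 < d x) ->
  scheme_solution alpha xL xR T N d phi f u -> (1 <= n <= N)%N ->
  Dnorm xL xR d (u n)
  <= Dnorm xL xR d (u n.-1) + stept T N * Dnorm xL xR d (fmid xL xR T M N f n).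
Proof.
move=> hx hT ha d_gt0 [_ /(_ n) hu] hn.
have h_gt0 : 0 < stepx xL xR M by rewrite divr_gt0 ?subr_gt0 // ltr0n.
have tau_gt0 : 0 < stept T N by rewrite divr_gt0 // ltr0n; lia.
have dx_gt0 (i : 'I_M) : 0 < d (gridx xL xR M i.+1).
  by apply: d_gt0; apply: gridx_mem => //; rewrite ltnS ltnW.
have DinnerE := fun v1 v2 => Dinner_wdot _ xL xR M d v1 v2
                               (fun i => lt0r_neq0 (dx_gt0 i)).
set p := (fun i : 'I_M => _) in DinnerE.
have p_ge0 i : 0 <= p i by rewrite divr_ge0 ?ltW.
have Dnorm2 v : Dnorm xL xR d v ^+ 2 = wdot p v v.
  by rewrite /Dnorm DinnerE sqr_sqrtr ?wdot_ge0.
have pD i : p i * (gridcol xL xR M d)^T 0 i = stepx xL xR M.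
  by rewrite !mxE /p mulfVK // lt0r_neq0.
have := energy_identity _ _ _ _ _ _ _ _ _ _ _ (lt0r_neq0 tau_gt0) pD (hu hn).
rewrite -!Dnorm2 wdotDr => energy.
apply: sqr_step_le; rewrite ?sqrtr_ge0 //.
  by rewrite mulr_ge0 ?sqrtr_ge0 ?ltW.
rewrite energy -[leRHS]mulrA ler_pM2l // -[leRHS]add0r mulrDr.
apply: lerD.
  rewrite mulr_ge0_le0 ?Gmx_form_le0 // mulr_ge0 ?(ltW h_gt0) // invr_ge0.
  by rewrite mulr_ge0 ?powR_ge0.
by rewrite /Dnorm !DinnerE lerD // wdot_CauchySchwarz.
Qed.

(* The seed 0 of the maximum is harmless: the terms are squares and the range
   1 <= k <= n is nonempty. *)
Theorem theorem2p1 (R : realType) (xL xR T alpha dminus dplus : R)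
    (d phi : R -> R) (f : R -> R -> R)
    (hx : xL < xR) (hT : 0 < T) (halpha : 1 < alpha < 2)
    (hdminus : 0 < dminus)
    (hd : forall x : R, xL <= x <= xR -> dminus <= d x <= dplus)
    (M N : nat) (hM : (0 < M)%N) (hN : (0 < N)%N)
    (u : nat -> 'cV[R]_M)
    (hu : scheme_solution alpha xL xR T N d phi f u)
    (n : nat) (hn : (1 <= n <= N)%N) :
  Dnorm xL xR d (u n) ^+ 2 <=
    expR (2 * T) * Dnorm xL xR d (gridcol xL xR M phi) ^+ 2
    + (expR (2 * T) - 1) *
      \big[Num.max/0]_(1 <= k < n.+1) Dnorm xL xR d (fmid xL xR T M N f k) ^+ 2.
Proof.
have d_gt0 x : xL <= x <= xR -> 0 < d x.
  by move=> /hd /andP[+ _]; apply: lt_le_trans.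
set m2 := \big[_/_]_(_ <= _ < _) _.
have m2_ge0 : 0 <= m2 by rewrite /m2 bigmax_idl le_max lexx.
pose m := Num.sqrt m2.
have f_le k : (1 <= k <= n)%N -> Dnorm xL xR d (fmid xL xR T M N f k) <= m.
  move=> hk; rewrite -[leLHS]ger0_norm ?sqrtr_ge0 // -sqrtr_sqr ler_sqrt //.
  apply: (le_bigmax_seq 0 k xpredT
            (fun k => Dnorm _ _ _ (fmid _ _ _ _ _ _ k) ^+ 2)) => //.
  by rewrite mem_index_iota ltnS.
have tau_ge0 : 0 <= stept T N by rewrite divr_ge0 // ltW.
have growth k : (k <= n)%N ->
    Dnorm xL xR d (u k) <= Dnorm xL xR d (u 0%N) + k%:R * (stept T N * m).
  elim: k => [|k IHk] le_kn; first by rewrite mul0r addr0.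
  have hkN : (1 <= k.+1 <= N)%N by case/andP: hn => _; apply: leq_trans.
  apply: (le_trans (scheme_step _ _ _ _ _ _ _ _ _ _ _ _
                      hx hT halpha d_gt0 hu hkN)).
  rewrite -natr1 mulrDl mul1r addrA.
  apply: lerD; first exact: IHk (ltnW le_kn).
  by apply: ler_wpM2l => //; exact: f_le.
have m_sqr : m2 = m ^+ 2 by rewrite sqr_sqrtr.
case: (hu) => u0 _; rewrite m_sqr -u0.
apply: (le_trans _ (sqr_growth_le _ _ _ _ hT)).
rewrite ler_sqr ?nnegrE ?addr_ge0 ?mulr_ge0 ?sqrtr_ge0 ?(ltW hT) //.
apply: (le_trans (growth n (leqnn n))).
rewrite lerD2l mulrA ler_wpM2r ?sqrtr_ge0 //.
rewrite /stept mulrCA ger_pMr // ler_pdivrMr ?ltr0n // mul1r ler_nat.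
by case/andP: hn.
Qed.
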